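(* Let $T>0$ and let $f\in C^1(\mathbb{R}_+\times\mathbb{R};\mathbb{R})$ satisfy $f(t+T,x)=f(t,x)$ for all $t\ge 0$, $x\in\mathbb{R}$. Consider the scalar differential equation $\dot x(t)=f(t,x(t))$, $x(t)\in\mathbb{R}$. Let $t_0\ge 0$, $x_0\in\mathbb{R}$ be given and suppose that the solution $\varphi(t,t_0,x_0)$ of the equation with initial condition $x(t_0)=x_0$ exists for all $t\ge t_0$ and is bounded on $[t_0,+\infty)$. Then there exists a $T$-periodic solution $x^*(t)$ of $\dot x(t)=f(t,x(t))$ such that $\lim_{t\to+\infty}\left(\left|\varphi(t,t_0,x_0)-x^*(t)\right|\right)=0$.
   Context: $\mathbb{R}_+=[0,+\infty)$. $C^1(\mathbb{R}_+\times\mathbb{R};\mathbb{R})$ is the class of real-valued functions with continuous first-order derivatives in the interior $(0,+\infty)\times\mathbb{R}$ that can be continued continuously to all of $\mathbb{R}_+\times\mathbb{R}$. For $t_0\ge 0$, $x_0\in\mathbb{R}$, $\varphi(t,t_0,x_0)$ denotes the value at time $t\ge t_0$ of the unique (maximally extended forward in time) solution of $\dot x(t)=f(t,x(t))$ with $x(t_0)=x_0$. A $T$-periodic solution is a solution $x^*$ satisfying $x^*(t+T)=x^*(t)$ for all $t\ge 0$ (constant solutions are allowed). *)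

(* Defs.v *)
From Stdlib Require Import Reals.
From Coquelicot Require Import Coquelicot.
Open Scope R_scope.

Definition half_plane (p : R * R) : Prop := 0 <= fst p.

(* The functions [ft] and [fx] are the continuous extensions to the closed
   half-plane of the partial derivatives, which are only required to exist for
   0 < t.  Nothing is assumed about [f t x] for t < 0. *)
Definition C1_half_plane (f : R -> R -> R) : Prop :=
  continuous_on half_plane (fun p => f (fst p) (snd p)) /\
  exists ft fx : R * R -> R,
    continuous_on half_plane ft /\
    continuous_on half_plane fx /\
    forall t x : R, 0 < t ->
      is_derive (fun s => f s x) t (ft (t, x)) /\
      is_derive (fun y => f t y) x (fx (t, x)).

(* Derivative relative to [D]: Coquelicot's [is_derive] with the neighbourhood
   filter of [t] restricted to [D], hence a one-sided derivative when [t] is an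
   endpoint of the interval [D]. *)
Definition is_derive_within (D : R -> Prop) (x : R -> R) (t l : R) : Prop :=
  filterdiff x (within D (locally t)) (fun h => scal h l).

(* [x] solves x' = f(t, x) on [t0, +oo), the equation at t0 being understood
   with the right derivative.  The values of [x] before t0 are irrelevant. *)
Definition is_solution_from (f : R -> R -> R) (t0 : R) (x : R -> R) : Prop :=
  forall t : R, t0 <= t ->
    is_derive_within (fun s => t0 <= s) x t (f t (x t)).

Definition is_periodic_solution (f : R -> R -> R) (T : R) (x : R -> R) : Prop :=
  is_solution_from f 0 x /\ forall t : R, 0 <= t -> x (t + T) = x t.

(* Main.v *)
Require Import Defs.
From Stdlib Require Import Reals Lra Lia Ranalysis5 ClassicalEpsilon.
From Coquelicot Require Import Coquelicot.
Open Scope R_scope.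

(** A bounded solution [w] is compared with its own translate by one period.
    By periodicity of [f], the function [t => w (t + T)] solves the same
    equation, and in dimension one two solutions cannot cross: once they meet
    they stay together ([zero_propagates]), so their difference keeps its sign
    ([nonneg_propagates]).  Hence for every [t] the sequence [w (t + n T)] is
    monotone in [n], with a direction that does not depend on [t]; being
    bounded, it has a limit [xs t] ([period_translates_converge]).

    Shifting [n] by one shows that [xs] is [T]-periodic.  A pointwise limit of
    solutions with a common speed bound is again a solution
    ([limit_of_solutions]).  Finally the translates are equi-Lipschitz, so they
    converge uniformly on [[0, T]] ([equilipschitz_converges_uniformly]), and
    uniform convergence of the [n]-th translate over one period says precisely
    that [w - xs] tends to 0 at infinity.

    Replacing [phi] by its translate by a multiple of [T] larger than [t0]
    leaves a function that is differentiable on both sides at every [t >= 0],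
    so in what follows one-sided derivatives matter only for the claim that [xs] is a
    solution at time 0. *)

(** * Functions continuous on the closed half-plane *)

Lemma continuous_on_half_plane_eps (g : R * R -> R) :
  continuous_on half_plane g ->
  forall t x eps, 0 <= t -> 0 < eps -> exists del : posreal,
    forall s y, 0 <= s -> Rabs (s - t) < del -> Rabs (y - x) < del ->
    Rabs (g (s, y) - g (t, x)) < eps.
Proof.
  intros hg t x eps ht heps.
  destruct (proj1 (filterlim_locally _ _) (hg (t, x) ht) (mkposreal eps heps))
    as [del hdel].
  exists del. intros s y hs hst hyx.
  apply (hdel (s, y)); [split; assumption | exact hs].
Qed.

(** Compactness of the box gives a positive lower bound [d] for any choice of
    radii attached to its points.  Radii are chosen so that [g] varies by less
    than 1 and also at most [/ (Rabs (g p) + 1)] at the centre [p]: then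
    [d <= radius] bounds [g p] by [/ d], and [g] by [/ d + 1] around [p]. *)
Lemma bounded_on_box (g : R * R -> R) :
  continuous_on half_plane g ->
  forall b M, exists K, forall t x, 0 <= t <= b -> Rabs x <= M ->
    Rabs (g (t, x)) <= K.
Proof.
  intros hg b M.
  assert (hloc : forall t x, exists del : posreal, 0 <= t ->
    del <= / (Rabs (g (t, x)) + 1) /\
    forall s y, 0 <= s -> Rabs (s - t) < del -> Rabs (y - x) < del ->
    Rabs (g (s, y) - g (t, x)) < 1).
  { intros t x. destruct (Rle_dec 0 t) as [ht | ht].
    2: { exists (mkposreal 1 Rlt_0_1). intros ht'. contradiction. }
    destruct (continuous_on_half_plane_eps g hg t x 1 ht Rlt_0_1) as [del hdel].
    assert (hp : 0 < / (Rabs (g (t, x)) + 1)).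
    { apply Rinv_0_lt_compat. generalize (Rabs_pos (g (t, x))). lra. }
    exists (mkposreal _ (Rmin_stable_in_posreal del (mkposreal _ hp))).
    intros _. simpl. split; [apply Rmin_r |].
    intros s y hs hst hyx. generalize (Rmin_l del (/ (Rabs (g (t, x)) + 1))).
    intros hm. apply hdel; lra. }
  set (del := fun t x => proj1_sig (constructive_indefinite_description _ (hloc t x))).
  destruct (compactness_value_2d 0 b (- M) M del) as [d hd].
  exists (/ d + 1). intros t x ht hx.
  apply Rnot_lt_le. intros hlt.
  apply (hd t x ht); [apply Rabs_le_between, hx |].
  intros (u & v & hu & hv & htu & hxv & hduv).
  revert htu hxv hduv. unfold del.
  destruct (constructive_indefinite_description _ (hloc u v)) as [e he]. simpl.
  intros htu hxv hduv. destruct (he (proj1 hu)) as [he1 he2].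
  specialize (he2 t x (proj1 ht) htu hxv).
  assert (hinv : Rabs (g (u, v)) + 1 <= / d).
  { rewrite <- (Rinv_inv (Rabs (g (u, v)) + 1)).
    apply Rinv_le_contravar; [apply cond_pos | lra]. }
  generalize (Rabs_triang_inv (g (t, x)) (g (u, v))). lra.
Qed.

(** * Scalar differential inequalities on the half-line *)

Lemma mean_value_half_line (v v' : R -> R) :
  (forall t, 0 <= t -> is_derive v t (v' t)) ->
  forall s t, 0 <= s -> 0 <= t -> exists c,
    0 <= c /\ Rabs (c - t) <= Rabs (s - t) /\ v s - v t = v' c * (s - t).
Proof.
  intros hv s t hs ht.
  assert (hmin : 0 <= Rmin t s) by (apply Rmin_glb; assumption).
  destruct (MVT_gen v t s v') as (c & hc & heq).
  - intros c hc. apply hv. lra.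
  - intros c hc. apply continuity_pt_filterlim.
    apply (ex_derive_continuous (V := R_NormedModule)).
    exists (v' c). apply hv. lra.
  - exists c. split; [lra | split; [| exact heq]].
    revert hc. unfold Rmin, Rmax. destruct (Rle_dec t s); intros hc;
      unfold Rabs; repeat destruct Rcase_abs; lra.
Qed.

Lemma lipschitz_of_bounded_derive (v v' : R -> R) K :
  (forall t, 0 <= t -> is_derive v t (v' t)) ->
  (forall t, 0 <= t -> Rabs (v' t) <= K) ->
  forall s t, 0 <= s -> 0 <= t -> Rabs (v s - v t) <= K * Rabs (s - t).
Proof.
  intros hv hK s t hs ht.
  destruct (mean_value_half_line v v' hv s t hs ht) as (c & hc & _ & heq).
  rewrite heq, Rabs_mult. apply Rmult_le_compat_r; [apply Rabs_pos | auto].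
Qed.

(** Gronwall's inequality without integrals: [d t ^ 2 * exp (- 2 L t)] is
    nonincreasing because [2 d d' <= 2 L d ^ 2], so it stays 0 once it
    vanishes. *)
Lemma zero_propagates (d d' : R -> R) L :
  (forall t, 0 <= t -> is_derive d t (d' t)) ->
  (forall t, 0 <= t -> Rabs (d' t) <= L * Rabs (d t)) ->
  forall a b, 0 <= a <= b -> d a = 0 -> d b = 0.
Proof.
  intros hd hL a b hab ha.
  destruct (mean_value_half_line (fun t => d t ^ 2 * exp (- (2 * L) * t))
    (fun t => (2 * d t * d' t - 2 * L * d t ^ 2) * exp (- (2 * L) * t)))
    with (s := b) (t := a) as (c & hc & _ & heq); [| lra | lra |].
  { intros t ht. specialize (hd t ht). auto_derive.
    - exists (d' t). exact hd.
    - replace (Derive (fun x => d x) t) with (d' t)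
        by (symmetry; apply is_derive_unique, hd). ring. }
  assert (hle : d c * d' c <= L * d c ^ 2).
  { apply Rle_trans with (Rabs (d c * d' c)); [apply Rle_abs |].
    rewrite Rabs_mult, <- (pow2_abs (d c)).
    replace (L * Rabs (d c) ^ 2) with (Rabs (d c) * (L * Rabs (d c))) by ring.
    apply Rmult_le_compat_l; [apply Rabs_pos | auto]. }
  simpl in heq. rewrite ha in heq.
  assert (hneg : 0 <= (2 * L * d c ^ 2 - 2 * d c * d' c)
                      * exp (- (2 * L) * c) * (b - a)).
  { apply Rmult_le_pos; [apply Rmult_le_pos |]; [lra | left; apply exp_pos | lra]. }
  assert (hpos := exp_pos (- (2 * L) * b)).
  destruct (Req_dec (d b) 0) as [h | h]; [exact h | exfalso].
  assert (h2 : 0 < d b ^ 2 * exp (- (2 * L) * b))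
    by (apply Rmult_lt_0_compat; [apply pow2_gt_0, h | exact hpos]).
  simpl in *. lra.
Qed.

(** A change of sign would force an intermediate zero, after which [d]
    vanishes identically. *)
Lemma nonneg_propagates (d d' : R -> R) L :
  (forall t, 0 <= t -> is_derive d t (d' t)) ->
  (forall t, 0 <= t -> Rabs (d' t) <= L * Rabs (d t)) ->
  0 <= d 0 -> forall t, 0 <= t -> 0 <= d t.
Proof.
  intros hd hL h0 t ht. apply Rnot_lt_le. intros hneg.
  destruct (Req_dec (d 0) 0) as [hz | hz].
  { rewrite (zero_propagates d d' L hd hL 0 t) in hneg; lra. }
  assert (ht0 : t <> 0) by (intros ->; lra).
  destruct (IVT_interv (fun s => - d s) 0 t) as (z & hzt & hdz); try lra.
  { intros s hs. apply continuity_pt_opp.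
    apply continuity_pt_filterlim.
    apply (ex_derive_continuous (V := R_NormedModule)).
    exists (d' s). apply hd. lra. }
  rewrite (zero_propagates d d' L hd hL z t) in hneg; lra.
Qed.

(** * Consequences of periodicity *)

Lemma iterate_period (T : R) (hT : 0 < T) (g : R -> R) :
  (forall t, 0 <= t -> g (t + T) = g t) ->
  forall n t, 0 <= t -> g (t + INR n * T) = g t.
Proof.
  intros hg n t ht. induction n as [| n IH].
  - simpl. f_equal. ring.
  - rewrite <- IH, <- (hg (t + INR n * T)).
    + f_equal. rewrite S_INR. ring.
    + generalize (Rmult_le_pos _ _ (pos_INR n) (Rlt_le _ _ hT)). lra.
Qed.

Lemma reduce_mod_period (T : R) (hT : 0 < T) t :
  0 <= t -> exists n s, 0 <= s <= T /\ t = s + INR n * T.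
Proof.
  intros ht.
  destruct (nfloor_ex (t / T)) as [n hn].
  { apply Rmult_le_pos; [exact ht | left; apply Rinv_0_lt_compat, hT]. }
  assert (heq : t = t / T * T) by (field; lra).
  exists n, (t - INR n * T). split; [| ring].
  generalize (Rmult_le_compat_r T _ _ (Rlt_le _ _ hT) (proj1 hn))
    (Rmult_lt_compat_r T _ _ hT (proj2 hn)). lra.
Qed.

(** The derivative in [x] is only available for positive times and its
    continuous extension is bounded on bounded time intervals; moving [t] by
    periods into [[T, 2 T]] settles both points at once and yields a constant
    valid for all [t >= 0], including [t = 0]. *)
Lemma lipschitz_in_x (T : R) (hT : 0 < T) f :
  C1_half_plane f ->
  (forall t x, 0 <= t -> f (t + T) x = f t x) ->
  forall M, exists L, forall t x y, 0 <= t -> Rabs x <= M -> Rabs y <= M ->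
    Rabs (f t y - f t x) <= L * Rabs (y - x).
Proof.
  intros (_ & ft & fx & _ & hfx & hder) hper M.
  destruct (bounded_on_box fx hfx (2 * T) M) as [L hL].
  exists L. intros t x y ht hx hy.
  destruct (reduce_mod_period T hT t ht) as (n & s & hs & ->).
  assert (hred : forall z, f (s + INR n * T) z = f (s + T) z).
  { intros z. rewrite (iterate_period T hT (fun r => f r z)), hper; try lra.
    intros r hr. apply hper, hr. }
  rewrite !hred.
  destruct (MVT_gen (f (s + T)) x y (fun z => fx (s + T, z))) as (c & hc & heq).
  - intros z _. apply hder. lra.
  - intros z _. apply continuity_pt_filterlim.
    apply (ex_derive_continuous (V := R_NormedModule)).
    exists (fx (s + T, z)). apply hder. lra.
  - rewrite heq, Rabs_mult. apply Rmult_le_compat_r; [apply Rabs_pos |].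
    apply hL; [lra |]. apply Rabs_le_between.
    apply Rabs_le_between in hx, hy.
    revert hc. unfold Rmin, Rmax. destruct (Rle_dec x y); lra.
Qed.

Lemma bounded_in_time (T : R) (hT : 0 < T) f :
  C1_half_plane f ->
  (forall t x, 0 <= t -> f (t + T) x = f t x) ->
  forall M, exists K, forall t x, 0 <= t -> Rabs x <= M -> Rabs (f t x) <= K.
Proof.
  intros [hf _] hper M.
  destruct (bounded_on_box _ hf T M) as [K hK].
  exists K. intros t x ht hx.
  destruct (reduce_mod_period T hT t ht) as (n & s & hs & ->).
  rewrite (iterate_period T hT (fun r => f r x)); [| intros; apply hper; lra | lra].
  apply (hK s x hs hx).
Qed.

(** * Solutions of the equation *)

Lemma is_derive_within_eps t0 (x : R -> R) t l : t0 <= t ->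
  is_derive_within (fun s => t0 <= s) x t l <->
  (forall eps, 0 < eps -> exists del : posreal, forall s, t0 <= s ->
    Rabs (s - t) < del -> Rabs (x s - x t - (s - t) * l) <= eps * Rabs (s - t)).
Proof.
  intros ht. split.
  - intros [_ h] eps heps.
    assert (hlim : is_filter_lim (within (fun s => t0 <= s) (locally t)) t).
    { intros P hP. apply filter_le_within, hP. }
    destruct (h t hlim (mkposreal eps heps)) as [del hdel].
    exists del. intros s hs hst. exact (hdel s hst hs).
  - intros h. split; [apply (is_linear_scal_l (V := R_NormedModule)) |].
    intros z hz.
    (* [t] lies in every neighbourhood of [t] relative to the domain, so the
       filter has no other limit. *)
    assert (hzt : z = t).
    { symmetry. apply Req_lt_aux. intros e.
      destruct (hz _ (locally_ball z e)) as [d hd].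
      apply (hd t (ball_center t d) ht). }
    subst z. intros eps.
    destruct (h eps (cond_pos eps)) as [del hdel].
    exists del. intros s hst hs. exact (hdel s hs hst).
Qed.

Lemma is_solution_from_is_derive f t0 x : is_solution_from f t0 x ->
  forall t, t0 < t -> is_derive x t (f t (x t)).
Proof.
  intros hx t ht.
  assert (h := proj1 (is_derive_within_eps t0 x t _ (Rlt_le _ _ ht))
                     (hx t (Rlt_le _ _ ht))).
  split; [apply (is_linear_scal_l (V := R_NormedModule)) |].
  intros z hz. rewrite <- (is_filter_lim_locally_unique _ _ hz). intros eps.
  destruct (h eps (cond_pos eps)) as [del hdel].
  assert (hp : 0 < t - t0) by lra.
  exists (mkposreal _ (Rmin_stable_in_posreal del (mkposreal _ hp))).
  intros s hs. change (Rabs (s - t) < Rmin del (t - t0)) in hs.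
  generalize (Rmin_l del (t - t0)) (Rmin_r del (t - t0)). intros h1 h2.
  apply (hdel s); [| lra].
  assert (hs' : Rabs (s - t) < t - t0) by lra.
  apply Rabs_lt_between in hs'. lra.
Qed.

Lemma is_lim_seq_eps (a : nat -> R) (l : R) : is_lim_seq a l ->
  forall eps, 0 < eps -> exists N, forall n, (N <= n)%nat -> Rabs (a n - l) < eps.
Proof.
  intros h eps heps.
  exact (proj2 (is_lim_seq_spec a l) h (mkposreal eps heps)).
Qed.

(** The mean value theorem writes the slope of [u n] between [t] and [s] as
    [f c (u n c)] with [c] between them.  The speed bound [K] keeps [u n c] close
    to [u n t], hence to [x t] for large [n], and continuity of [f] at
    [(t, x t)] makes the slope [eps]-close to [f t (x t)].  This estimate holds
    on a neighbourhood of [t] that does not depend on [n], so it passes to the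
    limit without any uniform convergence. *)
Lemma limit_of_solutions f (u : nat -> R -> R) (x : R -> R) K :
  continuous_on half_plane (fun p => f (fst p) (snd p)) ->
  (forall n t, 0 <= t -> is_derive (u n) t (f t (u n t))) ->
  (forall n t, 0 <= t -> Rabs (f t (u n t)) <= K) ->
  (forall t, 0 <= t -> is_lim_seq (fun n => u n t) (x t)) ->
  is_solution_from f 0 x.
Proof.
  intros hf hu hK hlim t ht. apply is_derive_within_eps; [exact ht |].
  intros eps heps.
  destruct (continuous_on_half_plane_eps _ hf t (x t) eps ht heps) as [del hdel].
  simpl in hdel.
  assert (hK0 : 0 <= K).
  { apply Rle_trans with (1 := Rabs_pos (f t (u 0%nat t))), hK, ht. }
  assert (hp : 0 < del / (2 * (K + 1))).
  { apply Rmult_lt_0_compat; [apply cond_pos | apply Rinv_0_lt_compat; lra]. }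
  (* Half of [del] is for [u n c - u n t], the other half for [u n t - x t];
     [K + 1] rather than [K] also gives [Rabs (s - t) < del]. *)
  exists (mkposreal _ hp). simpl. intros s hs hst.
  assert (hst' : (K + 1) * Rabs (s - t) < del / 2).
  { replace (del / 2) with ((K + 1) * (del / (2 * (K + 1)))) by (field; lra).
    apply Rmult_lt_compat_l; [lra | exact hst]. }
  assert (hpos := Rabs_pos (s - t)).
  assert (hKpos := Rmult_le_pos _ _ hK0 hpos).
  assert (hseq : is_lim_seq (fun n => Rabs (u n s - u n t - (s - t) * f t (x t)))
                   (Rabs (x s - x t - (s - t) * f t (x t)))).
  { apply (is_lim_seq_abs _ (Finite _)).
    apply is_lim_seq_minus'; [apply is_lim_seq_minus'; auto |].
    apply is_lim_seq_const. }
  destruct (is_lim_seq_eps _ _ (hlim t ht) (del / 2)) as [N hN].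
  { generalize (cond_pos del). lra. }
  apply (is_lim_seq_le_loc _ (fun _ => eps * Rabs (s - t))
           (Finite _) (Finite _)) with (2 := hseq) (3 := is_lim_seq_const _).
  exists N. intros n hn. specialize (hN n hn).
  destruct (mean_value_half_line (u n) _ (hu n) s t hs ht) as (c & hc & hct & heq).
  rewrite heq.
  replace (f c (u n c) * (s - t) - (s - t) * f t (x t))
    with ((f c (u n c) - f t (x t)) * (s - t)) by ring.
  rewrite Rabs_mult. apply Rmult_le_compat_r; [exact hpos |].
  left. apply hdel; [exact hc | lra |].
  assert (hcn := lipschitz_of_bounded_derive (u n) _ K (hu n) (hK n) c t hc ht).
  assert (hmul := Rmult_le_compat_l K _ _ hK0 hct).
  replace (u n c - x t) with ((u n c - u n t) + (u n t - x t)) by ring.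
  apply Rle_lt_trans with (1 := Rabs_triang _ _). lra.
Qed.

(** Pointwise convergence at the nodes of a grid of step [h] is enough, since
    the functions and their limit vary by less than [eps / 3] between
    nodes; the grid is traversed by induction on the number of its steps. *)
Lemma equilipschitz_converges_uniformly (u : nat -> R -> R) (x : R -> R) K :
  (forall n s t, 0 <= s -> 0 <= t -> Rabs (u n s - u n t) <= K * Rabs (s - t)) ->
  (forall t, 0 <= t -> is_lim_seq (fun n => u n t) (x t)) ->
  forall b eps, 0 < eps -> exists N, forall n t, (N <= n)%nat -> 0 <= t <= b ->
    Rabs (u n t - x t) < eps.
Proof.
  intros hu hlim b eps heps.
  assert (hx : forall s t, 0 <= s -> 0 <= t -> Rabs (x s - x t) <= K * Rabs (s - t)).
  { intros s t hs ht.
    apply (is_lim_seq_le (fun n => Rabs (u n s - u n t)) (fun _ => K * Rabs (s - t))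
             (Finite _) (Finite _)).
    - intros n. apply hu; assumption.
    - apply (is_lim_seq_abs _ (Finite _)), is_lim_seq_minus'; auto.
    - apply is_lim_seq_const. }
  assert (hK0 : 0 <= K).
  { assert (h := hu 0%nat 1 0 Rle_0_1 (Rle_refl 0)).
    rewrite Rminus_0_r, Rabs_R1, Rmult_1_r in h.
    apply Rle_trans with (2 := h), Rabs_pos. }
  set (h := eps / (3 * (K + 1))).
  assert (hh : 0 < h).
  { apply Rmult_lt_0_compat; [exact heps | apply Rinv_0_lt_compat; lra]. }
  assert (hKh : (K + 1) * h = eps / 3) by (unfold h; field; lra).
  assert (hgrid : forall k, exists N, forall n t, (N <= n)%nat ->
    0 <= t <= INR k * h -> Rabs (u n t - x t) < eps).
  { induction k as [| k [N hN]].
    - destruct (is_lim_seq_eps _ _ (hlim 0 (Rle_refl 0)) eps heps) as [N hN].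
      exists N. intros n t hn ht. simpl in ht.
      replace t with 0 by lra. auto.
    - set (p := INR k * h) in *.
      assert (hp : 0 <= p) by (apply Rmult_le_pos; [apply pos_INR | lra]).
      destruct (is_lim_seq_eps _ _ (hlim p hp) (eps / 3)) as [N' hN']; [lra |].
      exists (Nat.max N N'). intros n t hn ht.
      destruct (Rle_dec t p) as [htp | htp]; [apply hN; [lia | lra] |].
      rewrite S_INR in ht.
      assert (htp' : Rabs (t - p) <= h) by (unfold p in *; rewrite Rabs_pos_eq; lra).
      assert (h1 := hu n t p (proj1 ht) hp).
      assert (h2 := hx t p (proj1 ht) hp).
      assert (h3 : Rabs (u n p - x p) < eps / 3) by (apply hN'; lia).
      assert (h4 := Rmult_le_compat_l K _ _ hK0 htp').
      replace (u n t - x t)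
        with ((u n t - u n p) + (u n p - x p) - (x t - x p)) by ring.
      apply Rle_lt_trans with (1 := Rabs_triang _ _). rewrite Rabs_Ropp.
      generalize (Rabs_triang (u n t - u n p) (u n p - x p)). lra. }
  destruct (INR_archimed h b hh) as [k hk].
  destruct (hgrid k) as [N hN].
  exists N. intros n t hn ht. apply hN; [exact hn | lra].
Qed.

(** * Convergence of the translates by multiples of the period *)

Lemma is_derive_shift (v : R -> R) a t l :
  is_derive v (t + a) l -> is_derive (fun s => v (s + a)) t l.
Proof.
  intros h. auto_derive.
  - exists l. exact h.
  - replace (Derive (fun x : R => v x) (t + a)) with l
      by (symmetry; apply is_derive_unique, h). ring.
Qed.

(** The sign at time 0 of [d s = w (s + T) - w s] persists, and
    [d (t + n T)] is the [n]-th increment of the sequence: it is increasing or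
    decreasing according to that sign. *)
Lemma period_translates_converge (T : R) (hT : 0 < T) f (w : R -> R) M :
  C1_half_plane f ->
  (forall t x, 0 <= t -> f (t + T) x = f t x) ->
  (forall t, 0 <= t -> is_derive w t (f t (w t))) ->
  (forall t, 0 <= t -> Rabs (w t) <= M) ->
  forall t, 0 <= t -> ex_finite_lim_seq (fun n => w (t + INR n * T)).
Proof.
  intros hf hper hw hM t ht.
  destruct (lipschitz_in_x T hT f hf hper M) as [L hL].
  set (d := fun s => w (s + T) - w s).
  set (d' := fun s => f s (w (s + T)) - f s (w s)).
  assert (hd : forall s, 0 <= s -> is_derive d s (d' s)).
  { intros s hs. apply (is_derive_minus (V := R_NormedModule)); [| auto].
    rewrite <- hper by exact hs. apply is_derive_shift, hw. lra. }
  assert (hdL : forall s, 0 <= s -> Rabs (d' s) <= L * Rabs (d s)).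
  { intros s hs. apply hL; [exact hs | apply hM; lra | apply hM; lra]. }
  assert (hpos : forall n, 0 <= t + INR n * T).
  { intros n. generalize (Rmult_le_pos _ _ (pos_INR n) (Rlt_le _ _ hT)). lra. }
  assert (hS : forall n, t + INR (S n) * T = t + INR n * T + T).
  { intros n. rewrite S_INR. ring. }
  destruct (Rle_dec 0 (d 0)) as [h0 | h0].
  - apply ex_finite_lim_seq_incr with M; intros n.
    + rewrite hS.
      generalize (nonneg_propagates d d' L hd hdL h0 _ (hpos n)). unfold d. lra.
    + apply (Rabs_le_between _ M), hM, hpos.
  - apply ex_finite_lim_seq_decr with (- M); intros n.
    + rewrite hS.
      assert (h : 0 <= - d (t + INR n * T)).
      { apply (nonneg_propagates (fun s => - d s) (fun s => - d' s) L);
          [| | lra | apply hpos].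
        - intros s hs. apply (is_derive_opp (V := R_NormedModule)), hd, hs.
        - intros s hs. rewrite !Rabs_Ropp. auto. }
      unfold d in h. lra.
    + apply (Rabs_le_between _ M), hM, hpos.
Qed.

(** The theorem for solutions that start at time 0 and are differentiable on
    both sides there. *)
Lemma bounded_solution_asymptotically_periodic
  (T : R) (hT : 0 < T) f (w : R -> R) M :
  C1_half_plane f ->
  (forall t x, 0 <= t -> f (t + T) x = f t x) ->
  (forall t, 0 <= t -> is_derive w t (f t (w t))) ->
  (forall t, 0 <= t -> Rabs (w t) <= M) ->
  exists xs : R -> R, is_periodic_solution f T xs /\
    forall eps, 0 < eps -> exists A, forall t, A < t -> Rabs (w t - xs t) < eps.
Proof.
  intros hf hper hw hM.
  destruct (bounded_in_time T hT f hf hper M) as [K hK].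
  set (u := fun n t => w (t + INR n * T)).
  set (xs := fun t => real (Lim_seq (fun n => u n t))).
  assert (hnT : forall n, 0 <= INR n * T).
  { intros n. apply Rmult_le_pos; [apply pos_INR | lra]. }
  assert (hlim : forall t, 0 <= t -> is_lim_seq (fun n => u n t) (xs t)).
  { intros t ht. apply Lim_seq_correct'.
    apply (period_translates_converge T hT f w M hf hper hw hM t ht). }
  assert (hu : forall n t, 0 <= t -> is_derive (u n) t (f t (u n t))).
  { intros n t ht. apply is_derive_shift.
    rewrite <- (iterate_period T hT (fun r => f r (u n t))) with (n := n);
      [| intros; apply hper; lra | exact ht].
    apply hw. specialize (hnT n). lra. }
  assert (huM : forall n t, 0 <= t -> Rabs (f t (u n t)) <= K).
  { intros n t ht. apply hK; [exact ht |]. apply hM. specialize (hnT n). lra. }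
  assert (hxper : forall t, 0 <= t -> xs (t + T) = xs t).
  { intros t ht. unfold xs. rewrite <- (Lim_seq_incr_1 (fun n => u n t)).
    f_equal. apply Lim_seq_ext. intros n. unfold u. f_equal.
    rewrite S_INR. ring. }
  exists xs. split; [split; [| exact hxper] |].
  - apply (limit_of_solutions f u xs K (proj1 hf) hu huM hlim).
  - intros eps heps.
    destruct (equilipschitz_converges_uniformly u xs K) with (b := T) (eps := eps)
      as [N hN]; [| exact hlim | exact heps |].
    { intros n. apply lipschitz_of_bounded_derive with (1 := hu n), huM. }
    (* Since [s <= T], [s + n T > (N + 1) T] forces [n >= N]. *)
    exists (INR (S N) * T). intros t ht.
    destruct (reduce_mod_period T hT t) as (n & s & hs & ->).
    { specialize (hnT (S N)). lra. }
    rewrite (iterate_period T hT xs hxper) by apply hs.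
    apply hN; [| exact hs].
    apply INR_le, Rmult_le_reg_r with T; [exact hT |].
    rewrite S_INR in ht. lra.
Qed.

Theorem theorem1 (T : R) (hT : 0 < T) (f : R -> R -> R)
  (hf : C1_half_plane f)
  (hper : forall t x : R, 0 <= t -> f (t + T) x = f t x)
  (t0 x0 : R) (ht0 : 0 <= t0)
  (phi : R -> R)
  (hphi : is_solution_from f t0 phi)
  (hphi0 : phi t0 = x0)
  (hbounded : exists M : R, forall t : R, t0 <= t -> Rabs (phi t) <= M) :
  exists xs : R -> R,
    is_periodic_solution f T xs /\
    is_lim (fun t => Rabs (phi t - xs t)) p_infty 0.
Proof.
  destruct hbounded as [M hM].
  destruct (INR_archimed T t0 hT) as [N hN].
  destruct (bounded_solution_asymptotically_periodic T hT f
              (fun t => phi (t + INR N * T)) M hf hper) as (xs & hxs & hconv).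
  - intros t ht. apply is_derive_shift.
    rewrite <- (iterate_period T hT (fun r => f r (phi (t + INR N * T)))) with (n := N);
      [| intros; apply hper; lra | exact ht].
    apply (is_solution_from_is_derive f t0 phi hphi). lra.
  - intros t ht. apply hM. lra.
  - exists xs. split; [exact hxs |].
    apply (proj1 (is_lim_spec _ p_infty 0)). intros eps.
    destruct (hconv eps (cond_pos eps)) as [A hA].
    (* The maximum with 0 keeps [t - N T] in the range where [xs] is
       periodic. *)
    exists (Rmax A 0 + INR N * T). intros t ht.
    generalize (Rmax_l A 0) (Rmax_r A 0). intros h1 h2.
    rewrite Rminus_0_r, Rabs_Rabsolu.
    specialize (hA (t - INR N * T)).
    rewrite <- (iterate_period T hT xs (proj2 hxs) N (t - INR N * T)) in hA by lra.
    replace (t - INR N * T + INR N * T) with t in hA by ring.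
    apply hA. lra.
Qed.
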